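(* Let $\tilde\phi=\tilde\phi_S+\tilde\phi_A$ be an NDB structure on an $n$-dimensional real Lie algebra $\tilde{\mathfrak{g}}$. Suppose that there exists a nonzero element $e$ of the center of $\tilde{\mathfrak{g}}$ such that $\tilde\phi(e,e)=0$ and $$I^{\perp}=\{x\in\tilde{\mathfrak{g}}\mid\tilde\phi(e,x)=\tilde\phi(x,e)=0\}$$ is a codimension-one subspace of $\tilde{\mathfrak{g}}$. Then there exist an NDB Lie algebra $(\mathfrak{g},\phi)$ and double extension data $(\theta,D,\lambda,\alpha,k,k',l)$ for $(\mathfrak{g},\phi)$ such that $(\tilde{\mathfrak{g}},\tilde\phi)$ is obtained by (i.e. is isomorphic, by a Lie algebra isomorphism carrying one bilinear form to the other, to) the double extension of $(\mathfrak{g},\phi)$ by $(\theta,D,\lambda,\alpha,k,k',l)$.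
   Context: All Lie algebras are finite-dimensional over $\mathbb{R}$ (the zero Lie algebra is allowed). A bilinear form $\phi$ on a vector space $V$ is non-degenerate if $V\to V^*$, $x\mapsto\phi(x,\cdot)$, is an isomorphism. Write $\phi=\phi_S+\phi_A$ with $\phi_S$ the symmetric part and $\phi_A$ the skew-symmetric part. An NDB structure on a Lie algebra $\mathfrak{g}$ is a non-degenerate bilinear form $\phi$ on $\mathfrak{g}$ such that $\phi_A([x,y],z)+\phi_A([y,z],x)+\phi_A([z,x],y)=\phi_S(x,[y,z])$ for all $x,y,z\in\mathfrak{g}$; an NDB Lie algebra is a Lie algebra equipped with an NDB structure. Double extension. Let $(\mathfrak{g},\phi=\phi_S+\phi_A)$ be an NDB Lie algebra. Double extension data $(\theta,D,\lambda,\alpha,k,k',l)$ for $(\mathfrak{g},\phi)$ consist of a skew-symmetric bilinear form $\theta$ on $\mathfrak{g}$ with $d\theta=0$ (i.e. $\theta([x,y],z)+\theta([y,z],x)+\theta([z,x],y)=0$ for all $x,y,z\in\mathfrak{g}$), a derivation $D\in\operatorname{Der}(\mathfrak{g})$, linear forms $\lambda,\alpha\in\mathfrak{g}^*$, and real numbers $k,k',l$ with $k\neq\pm l$, such that for all $x,y\in\mathfrak{g}$: (1) $\lambda([x,y])=\theta(D(x),y)+\theta(x,D(y))$; (2) $\phi_S(D(x),y)+\phi_S(x,D(y))=0$; (3) $\alpha([x,y])+k\,\theta(x,y)-\phi_S(y,D(x))=0$; (4) $\alpha(D(x))+k\lambda(x)=0$; (5) $\phi_A(D(x),y)+\phi_A(x,D(y))+\alpha([x,y])+l\,\theta(x,y)+\phi_S(x,D(y))=0$.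 The double extension of $(\mathfrak{g},\phi)$ by $(\theta,D,\lambda,\alpha,k,k',l)$ is the NDB Lie algebra with underlying vector space $\mathbb{R}e\oplus\mathfrak{g}\oplus\mathbb{R}d$, Lie bracket determined (for $x,y\in\mathfrak{g}$) by $[x,y]^{\sim}=[x,y]+\theta(x,y)e$, $[d,x]^{\sim}=D(x)+\lambda(x)e$, and $e$ central, and bilinear form whose symmetric part $\Phi_S$ and skew-symmetric part $\Phi_A$ are determined as follows (for $x,y\in\mathfrak{g}$): $\Phi_S(e,e)=0$, $\Phi_S(e,x)=0$, $\Phi_S(e,d)=k$, $\Phi_S(x,y)=\phi_S(x,y)$, $\Phi_S(x,d)=\alpha(x)$, $\Phi_S(d,d)=k'$; $\Phi_A(e,x)=0$, $\Phi_A(e,d)=l$, $\Phi_A(x,y)=\phi_A(x,y)$, $\Phi_A(x,d)=\alpha(x)$. *)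

(* Defs.v *)
From HB Require Import structures.
From mathcomp Require Import all_boot all_order all_algebra.
From mathcomp Require Import ring lra.
From mathcomp Require Import reals.

Set Implicit Arguments.
Unset Strict Implicit.
Unset Printing Implicit Defensive.

Import Order.TTheory GRing.Theory Num.Theory.
Local Open Scope ring_scope.

Record lieAlgebra (R : realType) := LieAlgebra {
  lie_space :> vectType R;
  lie_bracket : {bilinear lie_space -> lie_space -> lie_space};
  lie_bracketxx : forall x, lie_bracket x x = 0;
  lie_jacobi : forall x y z,
    lie_bracket x (lie_bracket y z) + lie_bracket y (lie_bracket z x)
      + lie_bracket z (lie_bracket x y) = 0
}.

Lemma lie_bracketC (R : realType) (g : lieAlgebra R) (x y : g) :
  lie_bracket g x y = - lie_bracket g y x.
Proof.
have := lie_bracketxx (x + y).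
rewrite linearDl !linearDr /= !lie_bracketxx add0r addr0.
by move=> /eqP; rewrite addr_eq0 => /eqP.
Qed.

Notation "[ 'lie' x , y ]" := (lie_bracket _ x y)
  (at level 0, x, y at level 99, format "[ 'lie'  x ,  y ]") : ring_scope.

Definition in_center (R : realType) (g : lieAlgebra R) (x : g) : Prop :=
  forall y : g, [lie x, y] = 0.

Definition derivation (R : realType) (g : lieAlgebra R) (D : 'End(g)) : Prop :=
  forall x y : g, D [lie x, y] = [lie D x, y] + [lie x, D y].

Section BilinearForms.
Context {R : realType} {V : vectType R}.

Definition sym_part (phi : V -> V -> R) (x y : V) : R :=
  (phi x y + phi y x) / 2.

Definition skew_part (phi : V -> V -> R) (x y : V) : R :=
  (phi x y - phi y x) / 2.

Fact sym_part_bilinear (phi : {biscalar V}) :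
  bilinear_for *%R *%R (sym_part phi).
Proof.
by split=> u c x y; rewrite /sym_part linearPl linearPr /=; field.
Qed.

HB.instance Definition _ (phi : {biscalar V}) :=
  bilinear_isBilinear.Build R V V R *%R *%R (sym_part phi)
    (sym_part_bilinear phi).

Fact skew_part_bilinear (phi : {biscalar V}) :
  bilinear_for *%R *%R (skew_part phi).
Proof.
by split=> u c x y; rewrite /skew_part linearPl linearPr /=; field.
Qed.

HB.instance Definition _ (phi : {biscalar V}) :=
  bilinear_isBilinear.Build R V V R *%R *%R (skew_part phi)
    (skew_part_bilinear phi).

Definition form_to_dual (phi : {biscalar V}) (x : V) : 'Hom(V, R^o) :=
  linfun (phi x : V -> R^o).

Lemma form_to_dualE (phi : {biscalar V}) (x y : V) :
  form_to_dual phi x y = phi x y.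
Proof.
pose f : V -> R^o := phi x.
have lf : linear f by move=> a u v; rewrite /f linearPr.
pose fl := GRing.isLinear.Build _ _ _ _ f lf.
pose F : {linear V -> R^o} := HB.pack f fl.
exact: (lfunE F y).
Qed.

Lemma form_to_dual_linear (phi : {biscalar V}) : linear (form_to_dual phi).
Proof.
move=> a u v; apply/lfunP => y.
by rewrite add_lfunE scale_lfunE !form_to_dualE linearPl.
Qed.

(* A bijective linear map is an isomorphism; for the linearity of
   [form_to_dual phi], see [form_to_dual_linear]. *)
Definition nondegenerate_form (phi : {biscalar V}) : Prop :=
  bijective (form_to_dual phi).

Lemma nondegenerate_formP (phi : {biscalar V}) :
  (forall x, (forall y, phi x y = 0) -> x = 0) -> nondegenerate_form phi.
Proof.
move=> H; pose f : V -> 'Hom(V, R^o) := form_to_dual phi.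
pose fl := GRing.isLinear.Build _ _ _ _ f (form_to_dual_linear phi).
pose F : {linear V -> 'Hom(V, R^o)} := HB.pack f fl.
have kF : lker (linfun F) == 0%VS.
  apply/lker0P => x y; rewrite !lfunE /= => exy.
  apply/eqP; rewrite -subr_eq0; apply/eqP; apply: H => z.
  by rewrite linearBl /= -!form_to_dualE -/(f x) -/(f y) exy subrr.
have iF : limg (linfun F) = fullv.
  apply/eqP; rewrite eqEdim subvf /= limg_dim_eq ?(eqP kF) ?capv0 //.
  by rewrite !dimvf /dim /= muln1.
exists (linfun F)^-1%VF => [x|h].
  by rewrite -[form_to_dual phi x](lfunE F) lker0_lfunK.
by rewrite -[LHS](lfunE F) limg_lfunVK // iF memvf.
Qed.

End BilinearForms.

Definition ndb_structure (R : realType) (g : lieAlgebra R) (phi : {biscalar g})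
    : Prop :=
  nondegenerate_form phi /\
  forall x y z : g,
    skew_part phi [lie x, y] z + skew_part phi [lie y, z] x
      + skew_part phi [lie z, x] y = sym_part phi x [lie y, z].

Record ndbLieAlgebra (R : realType) := NdbLieAlgebra {
  ndb_lie :> lieAlgebra R;
  ndb_form : {biscalar ndb_lie};
  ndb_formP : ndb_structure ndb_form
}.

Record ndb_iso (R : realType) (g h : ndbLieAlgebra R) := NdbIso {
  ndb_iso_map : 'Hom(g, h);
  ndb_iso_bij : bijective ndb_iso_map;
  ndb_iso_bracket : forall x y : g,
    ndb_iso_map [lie x, y] = [lie ndb_iso_map x, ndb_iso_map y];
  ndb_iso_form : forall x y : g,
    ndb_form h (ndb_iso_map x) (ndb_iso_map y) = ndb_form g x y
}.

Definition ndb_isomorphic (R : realType) (g h : ndbLieAlgebra R) : Prop :=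
  inhabited (ndb_iso g h).

Record doubleExtData (R : realType) (g : ndbLieAlgebra R) := DoubleExtData {
  de_theta : {biscalar g};
  de_D : 'End(g);
  de_lambda : 'Hom(g, R^o);
  de_alpha : 'Hom(g, R^o);
  de_k : R;
  de_k' : R;
  de_l : R;
  de_theta_skew : forall x y : g, de_theta x y = - de_theta y x;
  de_theta_closed : forall x y z : g,
    de_theta [lie x, y] z + de_theta [lie y, z] x + de_theta [lie z, x] y = 0;
  de_derivation : derivation de_D;
  de_neq_kl : de_k != de_l;
  de_neq_kNl : de_k != - de_l;
  de_cond1 : forall x y : g,
    de_lambda [lie x, y] = de_theta (de_D x) y + de_theta x (de_D y);
  de_cond2 : forall x y : g,
    sym_part (ndb_form g) (de_D x) y + sym_part (ndb_form g) x (de_D y) = 0;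
  de_cond3 : forall x y : g,
    de_alpha [lie x, y] + de_k * de_theta x y
      - sym_part (ndb_form g) y (de_D x) = 0;
  de_cond4 : forall x : g, de_alpha (de_D x) + de_k * de_lambda x = 0;
  de_cond5 : forall x y : g,
    skew_part (ndb_form g) (de_D x) y + skew_part (ndb_form g) x (de_D y)
      + de_alpha [lie x, y] + de_l * de_theta x y
      + sym_part (ndb_form g) x (de_D y) = 0
}.

Lemma scalar_separates (R : fieldType) (V : vectType R) (u v : V) :
  (forall f : {scalar V}, f u = f v) -> u = v.
Proof.
move=> H; rewrite (coord_vbasis (memvf u)) (coord_vbasis (memvf v)).
apply: eq_bigr => i _; congr (_ *: _).
exact: H.
Qed.

Section DoubleExtension.
Context {R : realType} {g : ndbLieAlgebra R} (E : doubleExtData g).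

Local Notation phi := (ndb_form g).
Local Notation theta := (de_theta E).
Local Notation D := (de_D E).
Local Notation lambda := (de_lambda E).
Local Notation alpha := (de_alpha E).
Local Notation k := (de_k E).
Local Notation k' := (de_k' E).
Local Notation l := (de_l E).

(* A triple [(a, x, s)] stands for [a e + x + s d] in R e (+) g (+) R d. *)
Definition double_ext_space : vectType R := (R^o * g * R^o)%type.

Definition de_vec (a : R) (x : g) (s : R) : double_ext_space := (a, x, s).
Definition de_e : double_ext_space := de_vec 1 0 0.
Definition de_incl (x : g) : double_ext_space := de_vec 0 x 0.
Definition de_d : double_ext_space := de_vec 0 0 1.

Definition double_ext_bracket (u v : double_ext_space) : double_ext_space :=
  let: (_, x, s) := u in let: (_, y, t) := v in
  de_vec (theta x y + s * lambda y - t * lambda x)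
         ([lie x, y] + s *: D y - t *: D x) 0.

Definition double_ext_sym (u v : double_ext_space) : R :=
  let: (a, x, s) := u in let: (b, y, t) := v in
  sym_part phi x y + k * (a * t + s * b) + (alpha x * t + s * alpha y)
    + k' * (s * t).

Definition double_ext_skew (u v : double_ext_space) : R :=
  let: (a, x, s) := u in let: (b, y, t) := v in
  skew_part phi x y + l * (a * t - s * b) + (alpha x * t - s * alpha y).

Definition double_ext_form (u v : double_ext_space) : R :=
  double_ext_sym u v + double_ext_skew u v.

Let scaleRE (a b : R) : a *: (b : R^o) = a * b. Proof. by []. Qed.

Lemma de_eq (u v : double_ext_space) :
  u.1.1 = v.1.1 -> u.1.2 = v.1.2 -> u.2 = v.2 -> u = v.
Proof. by case: u v => [[a x] s] [[b y] t] /= -> -> ->. Qed.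

Lemma de_vecE a x s :
  de_vec a x s = a *: de_e + de_incl x + s *: de_d.
Proof.
apply/eqP; rewrite !xpair_eqE /=.
by rewrite !scaler0 !addr0 !add0r !scaleRE !mulr1 !eqxx.
Qed.

Lemma double_ext_bracket_incl x y :
  double_ext_bracket (de_incl x) (de_incl y) =
  de_incl [lie x, y] + theta x y *: de_e.
Proof.
apply/eqP; rewrite !xpair_eqE /=.
rewrite !scale0r !mul0r !subr0 !addr0 !scaler0 !add0r !scaleRE.
by rewrite mulr1 addr0 !eqxx.
Qed.

Lemma double_ext_bracket_d x :
  double_ext_bracket de_d (de_incl x) = de_incl (D x) + lambda x *: de_e.
Proof.
apply/eqP; rewrite !xpair_eqE /=.
rewrite !scale0r !mul0r !linear0l !scale1r !mul1r !subr0 !scaler0 !addr0 !add0r.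
by rewrite !scaleRE mulr1 !eqxx.
Qed.

Lemma double_ext_bracket_e u : double_ext_bracket de_e u = 0.
Proof.
case: u => [[b y] t]; apply/eqP; rewrite !xpair_eqE /=.
by rewrite !linear0l !linear0 !mul0r !scale0r !mulr0 ?scaler0 !subr0 !addr0 !eqxx.
Qed.

Lemma double_ext_form_sym : sym_part double_ext_form =2 double_ext_sym.
Proof.
case=> [[a x] s] [[b y] t].
by rewrite /sym_part /double_ext_form /= /sym_part /skew_part; field.
Qed.

Lemma double_ext_form_skew : skew_part double_ext_form =2 double_ext_skew.
Proof.
case=> [[a x] s] [[b y] t].
by rewrite /skew_part /double_ext_form /= /sym_part /skew_part; field.
Qed.

Fact double_ext_form_bilinear : bilinear_for *%R *%R double_ext_form.
Proof.
split=> [[[b y] t]|[[b y] t]] c [[a1 x1] s1] [[a2 x2] s2];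
  rewrite /double_ext_form /= /sym_part /skew_part;
  rewrite ?linearPl ?linearPr !linearP /= ?scaleRE; by field.
Qed.

HB.instance Definition _ :=
  bilinear_isBilinear.Build R double_ext_space double_ext_space R *%R *%R
    double_ext_form double_ext_form_bilinear.

Fact double_ext_bracket_bilinear : bilinear_for *:%R *:%R double_ext_bracket.
Proof.
split=> [[[b y] t]|[[b y] t]] c [[a1 x1] s1] [[a2 x2] s2]; apply: de_eq => /=.
- by rewrite linearPl linearP /= !scaleRE; ring.
- apply: scalar_separates => f.
  by rewrite linearPl linearP /= !(linearD f, linearN f, scalarZ f) /= ?scaleRE;
    ring.
- by rewrite !scaleRE; ring.
- by rewrite linearPr linearP /= !scaleRE; ring.
- apply: scalar_separates => f.
  by rewrite linearPr linearP /= !(linearD f, linearN f, scalarZ f) /= ?scaleRE;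
    ring.
- by rewrite !scaleRE; ring.
Qed.

HB.instance Definition _ :=
  bilinear_isBilinear.Build R double_ext_space double_ext_space double_ext_space
   *:%R *:%R double_ext_bracket double_ext_bracket_bilinear.

Fact double_ext_bracketxx u : double_ext_bracket u u = 0.
Proof.
case: u => [[a x] s]; apply: de_eq => //=.
- by have := de_theta_skew E x x; lra.
- by rewrite lie_bracketxx add0r subrr.
Qed.

Fact double_ext_jacobi u v w :
  double_ext_bracket u (double_ext_bracket v w)
    + double_ext_bracket v (double_ext_bracket w u)
    + double_ext_bracket w (double_ext_bracket u v) = 0.
Proof.
case: u v w => [[a x] r] [[b y] s] [[c z] t]; apply: de_eq => /=.
- rewrite !(linearDr, linearNr, linearZr_LR, linearD, linearN, linearZ) /=.
  rewrite !scaleRE !(de_cond1 E).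
  have := de_theta_closed E x y z; rewrite !(de_theta_skew E [lie _, _] _).
  rewrite !(de_theta_skew E (D _) _) => H.
  have -> : theta x [lie y, z] = - theta z [lie x, y] - theta y [lie z, x].
    by lra.
  by ring.
- apply: scalar_separates => f; have DL := de_derivation E.
  rewrite !(linearDr, linearNr, linearZr_LR, linearD, linearN, linearZ) /=.
  have H := congr1 f (lie_jacobi x y z).
  rewrite !DL !(linearD f) linear0 in H *.
  rewrite (lie_bracketC (D y) z) (lie_bracketC (D z) x) (lie_bracketC (D x) y).
  rewrite !(linearN f).
  have -> : f [lie x, [lie y, z]]
      = - f [lie y, [lie z, x]] - f [lie z, [lie x, y]] by lra.
  by ring.
- by rewrite !addr0.
Qed.

Fact double_ext_nondegenerate : nondegenerate_form double_ext_form.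
Proof.
apply: nondegenerate_formP => -[[a x] s] H0.
have H v : double_ext_form (a, x, s) v = 0 by exact: H0.
have s0 : s = 0.
  have : (k - l) * s = 0.
    rewrite -(H de_e) /double_ext_form /= linear0r (linear0r (skew_part phi)).
    by rewrite linear0; ring.
  by move/eqP; rewrite mulf_eq0 subr_eq0 (negbTE (de_neq_kl E)) => /eqP.
have x0 : x = 0.
  have [[h hK _] _] := ndb_formP g; rewrite -[x]hK -[RHS]hK; congr h.
  apply/lfunP => y; rewrite !form_to_dualE linear0l -(H (de_incl y)).
  by rewrite /double_ext_form s0 /= /sym_part /skew_part; field.
have a0 : a = 0.
  have : (k + l) * a = 0.
    rewrite -(H de_d) /double_ext_form /= s0 x0 linear0l.
    by rewrite (linear0l (skew_part phi)) linear0; ring.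
  by move/eqP; rewrite mulf_eq0 addr_eq0 (negbTE (de_neq_kNl E)) => /eqP.
by rewrite s0 x0 a0.
Qed.

Fact double_ext_ndb x y z :
  double_ext_skew (double_ext_bracket x y) z
    + double_ext_skew (double_ext_bracket y z) x
    + double_ext_skew (double_ext_bracket z x) y
  = double_ext_sym x (double_ext_bracket y z).
Proof.
case: x y z => [[a x] r] [[b y] s] [[c z] t] /=.
rewrite !(linearPl, linearDr, linearNr, linearZr_LR, linearDl, linearNl, linearZl_LR, linearD, linearN, linearZ) /= !scaleRE.
have h0 := (ndb_formP g).2 x y z.
have symC p q : sym_part phi p q = sym_part phi q p by rewrite /sym_part addrC.
have skewC p q : skew_part phi p q = - skew_part phi q p.
  by rewrite /skew_part; field.
have c4 w : alpha (D w) = - (k * lambda w).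
  by apply/eqP; rewrite -addr_eq0 de_cond4.
have c5 p q : skew_part phi (D p) q
    = skew_part phi (D q) p - alpha [lie p, q] - l * theta p q
      - sym_part phi p (D q).
  by have := de_cond5 E p q; rewrite (skewC p (D q)); lra.
have c3 : alpha [lie y, z] + k * theta y z = - sym_part phi y (D z).
  have := de_cond3 E y z; have := de_cond2 E y z.
  by rewrite (symC z (D y)); lra.
have c2 : sym_part phi x (D z) = - sym_part phi z (D x).
  by have := de_cond2 E x z; rewrite (symC (D x) z); lra.
rewrite -h0 !c4 (c5 x y) (c5 y z) (c5 z x) c2.
have -> : k * (a * 0 + r * (theta y z + s * lambda z + t * - lambda y))
    = r * (- sym_part phi y (D z) - alpha [lie y, z]
           + k * (s * lambda z - t * lambda y)).
  by rewrite -c3; ring.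
by ring.
Qed.

Definition double_ext_lie : lieAlgebra R :=
  @LieAlgebra R double_ext_space double_ext_bracket
    double_ext_bracketxx double_ext_jacobi.

Fact double_ext_ndb_structure :
  @ndb_structure R double_ext_lie double_ext_form.
Proof.
split=> [|x y z]; first exact: double_ext_nondegenerate.
have := double_ext_ndb x y z.
by rewrite -!double_ext_form_skew -double_ext_form_sym.
Qed.

Definition double_extension : ndbLieAlgebra R :=
  @NdbLieAlgebra R double_ext_lie double_ext_form double_ext_ndb_structure.

End DoubleExtension.

(* Main.v *)
Require Import Defs.
From HB Require Import structures.
From mathcomp Require Import all_boot all_order all_algebra.
From mathcomp Require Import ring lra.
From mathcomp Require Import reals.

Set Implicit Arguments.
Unset Strict Implicit.
Unset Printing Implicit Defensive.

Import Order.TTheory GRing.Theory Num.Theory.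
Local Open Scope ring_scope.

(** Write S and A for the symmetric and skew-symmetric parts of the form phi.
    The left-hand side of the NDB identity is invariant under cyclic
    permutations of (x, y, z), hence so is S(x, [y, z]); this is the
    ad-invariance of S ([ndb_sym_invariant]).  With the central element e in the
    first or in the last slot, the identity forces e to be orthogonal on both
    sides to all brackets ([ndb_center_bracket]), so the derived algebra lies in
    I^perp.

    As I^perp has codimension one, phi(e, -) and phi(-, e) are nonzero
    multiples of one another.  Fix d outside I^perp; then phi(e, d) and
    phi(d, e) are both nonzero.  Let W be the set of x such that
    phi(e, x) = phi(d, x) = 0.  Since phi(d, e) is nonzero, W is a complement
    of Re in I^perp, and the algebra splits as Re + W + Rd.  Among the
    complements of Re in I^perp, this one is forced by the double extension:
    there S(x, d) = A(x, d) = alpha(x), that is phi(d, x) = 0 for x in W.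

    The quotient algebra I^perp / Re is carried by W, with bracket the
    W-component of [x, y], and phi restricts to an NDB structure on it
    ([middle_ndb]).  The remaining data are read off from the brackets:
    theta(x, y) and lambda(x) are the e-components of [x, y] and [d, x], D(x)
    is the W-component of [d, x], alpha(x) = phi(x, d) / 2, k = S(e, d),
    k' = phi(d, d) and l = A(e, d); then k + l = phi(e, d) and
    k - l = phi(d, e) are nonzero.  The Jacobi identity gives the closedness of
    theta, the derivation property and condition (1); the ad-invariance of S
    gives (2), (3) and (4); the NDB identity at (x, y, d) gives (5).  The
    coordinates along Re + W + Rd form the isomorphism ([reduction_iso]). *)

(** * Bilinear forms, brackets and NDB structures *)

Section FormParts.
Context {R : realType} {V : vectType R} (phi : {biscalar V}).

Lemma sym_partC x y : sym_part phi x y = sym_part phi y x.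
Proof. by rewrite /sym_part addrC. Qed.

Lemma skew_partC x y : skew_part phi x y = - skew_part phi y x.
Proof. by rewrite /skew_part; field. Qed.

(** Nondegeneracy makes every linear form equal to some phi(x, -), and linear
    forms separate points. *)
Lemma nondegenerate_right y :
  nondegenerate_form phi -> (forall x, phi x y = 0) -> y = 0.
Proof.
case=> h _ hK phiy0; apply: scalar_separates => f; rewrite linear0.
by rewrite -(lfunE (f : {linear V -> R^o})) -[linfun _]hK form_to_dualE phiy0.
Qed.

Lemma nondegenerate_left x :
  nondegenerate_form phi -> (forall y, phi x y = 0) -> x = 0.
Proof.
case=> h hK _ phix0; rewrite -[x]hK -[RHS]hK; congr h.
by apply/lfunP => y; rewrite !form_to_dualE phix0 linear0l.
Qed.

End FormParts.

Lemma lie_leibniz (R : realType) (g : lieAlgebra R) (d x y : g) :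
  [lie d, [lie x, y]] = [lie [lie d, x], y] + [lie x, [lie d, y]].
Proof.
have := lie_jacobi d x y.
rewrite (lie_bracketC y d) (lie_bracketC y) linearNr /=.
move/eqP; rewrite -addrA -opprD subr_eq0 => /eqP ->.
by rewrite addrC.
Qed.

Section NdbIdentities.
Context {R : realType} {g : lieAlgebra R} {phi : {biscalar g}}.
Hypothesis phi_ndb : ndb_structure phi.

(** The other side of the NDB identity is unchanged by a cyclic permutation of
    x, y, z. *)
Lemma ndb_sym_invariant x y z :
  sym_part phi x [lie y, z] = sym_part phi y [lie z, x].
Proof. by rewrite -!(phi_ndb.2); ring. Qed.

Lemma ndb_sym_bracketxx x y : sym_part phi x [lie x, y] = 0.
Proof. by rewrite 2!ndb_sym_invariant lie_bracketxx linear0r. Qed.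

(** The NDB identity at (e, x, y) reads A([x, y], e) = S(e, [x, y]), and at
    (x, y, e) it reads A([x, y], e) = 0; hence both parts of phi vanish on the
    pair. *)
Lemma ndb_center_bracket e x y : in_center e ->
  phi e [lie x, y] = 0 /\ phi [lie x, y] e = 0.
Proof.
move=> eC.
have eCr z : [lie z, e] = 0 by rewrite lie_bracketC eC oppr0.
have := phi_ndb.2 e x y; have := phi_ndb.2 x y e.
rewrite eC !eCr !linear0l linear0r /skew_part /sym_part.
by split; lra.
Qed.

End NdbIdentities.

(** * The splitting Re + W + Rd *)

Section Reduction.
Context {R : realType} {gt : lieAlgebra R} {phi : {biscalar gt}}.
Hypothesis phi_ndb : ndb_structure phi.
Context {e d : gt}.
Hypothesis eC : in_center e.
Hypothesis phi_ee : phi e e = 0.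
Hypothesis phi_ed : phi e d != 0.
Hypothesis phi_de : phi d e != 0.
Hypothesis phi_e_left : forall z, phi e z = 0 -> phi z e = 0.

(** This is the complement of Re in I^perp that is left orthogonal to d, as W is
    in a double extension.  By [phi_e_left], the kernel of phi(e, -) is all of
    I^perp. *)
Definition middle_space : {vspace gt} :=
  (lker (form_to_dual phi e) :&: lker (form_to_dual phi d))%VS.

Local Notation W := (subvs_of middle_space).

Lemma mem_middle z :
  (z \in middle_space) = (phi e z == 0) && (phi d z == 0).
Proof. by rewrite memv_cap !memv_ker !form_to_dualE. Qed.

Lemma phi_e_middle (x : W) : phi e (vsval x) = 0.
Proof. by have := subvsP x; rewrite mem_middle => /andP[/eqP]. Qed.

Lemma phi_d_middle (x : W) : phi d (vsval x) = 0.
Proof. by have := subvsP x; rewrite mem_middle => /andP[_ /eqP]. Qed.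

Lemma phi_middle_e (x : W) : phi (vsval x) e = 0.
Proof. exact/phi_e_left/phi_e_middle. Qed.

(** Apply phi(e, -) and then phi(d, -) to z = a e + w + s d: the first gives
    s phi(e, d), the second a phi(d, e) + s phi(d, d). *)
Definition d_coord : 'Hom(gt, R^o) := (phi e d)^-1 *: form_to_dual phi e.

Definition e_coord : 'Hom(gt, R^o) :=
  (phi d e)^-1 *: (form_to_dual phi d - phi d d *: d_coord).

Lemma d_coordE z : d_coord z = phi e z / phi e d.
Proof. by rewrite scale_lfunE form_to_dualE mulrC. Qed.

Lemma e_coordE z : e_coord z = (phi d z - d_coord z * phi d d) / phi d e.
Proof.
rewrite scale_lfunE add_lfunE opp_lfunE scale_lfunE form_to_dualE.
by rewrite mulrC [_ *: d_coord z]mulrC.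
Qed.

Lemma e_coord_mul z : e_coord z * phi d e = phi d z - d_coord z * phi d d.
Proof. by rewrite e_coordE mulfVK. Qed.

Lemma d_coord_mul z : d_coord z * phi e d = phi e z.
Proof. by rewrite d_coordE mulfVK. Qed.

Definition middle_coord (z : gt) : W :=
  vsproj middle_space (z - e_coord z *: e - d_coord z *: d).

Fact middle_coord_linear : linear middle_coord.
Proof.
move=> a u v; rewrite /middle_coord -linearP /=; congr vsproj.
apply: scalar_separates => f.
rewrite !linearP /= !(linearD f, linearN f, scalarZ f).
by rewrite -[a *: e_coord u]/(a * _) -[a *: d_coord u]/(a * _); ring.
Qed.

HB.instance Definition _ :=
  GRing.isLinear.Build R gt W *:%R middle_coord middle_coord_linear.

Lemma val_middle_coord z :
  vsval (middle_coord z) = z - e_coord z *: e - d_coord z *: d.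
Proof.
rewrite vsprojK // mem_middle !linearBr !linearZr_LR /=.
rewrite phi_ee d_coord_mul e_coord_mul mulr0 subr0 subrr eqxx /=.
by rewrite opprB addrCA subrr addr0 subrr.
Qed.

Lemma coord_decomposition z :
  z = e_coord z *: e + vsval (middle_coord z) + d_coord z *: d.
Proof. by rewrite val_middle_coord -addrA subrK addrC subrK. Qed.

Lemma d_coord_bracket x y : d_coord [lie x, y] = 0.
Proof.
by rewrite d_coordE (ndb_center_bracket phi_ndb x y eC).1 mul0r.
Qed.

Lemma val_middle_bracket x y :
  vsval (middle_coord [lie x, y]) = [lie x, y] - e_coord [lie x, y] *: e.
Proof. by rewrite val_middle_coord d_coord_bracket scale0r subr0. Qed.

(** Replacing a bracket by its W-component changes it by a multiple of the
    central e only, which further brackets do not see; so the Jacobi and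
    Leibniz identities pass to W. *)
Lemma bracket_middle_r x y z :
  [lie x, vsval (middle_coord [lie y, z])] = [lie x, [lie y, z]].
Proof.
rewrite val_middle_bracket linearBr linearZr_LR /=.
by rewrite (lie_bracketC x e) eC oppr0 scaler0 subr0.
Qed.

Lemma bracket_middle_l x y z :
  [lie vsval (middle_coord [lie y, z]), x] = [lie [lie y, z], x].
Proof. by rewrite lie_bracketC bracket_middle_r -lie_bracketC. Qed.

(** Likewise phi does not see that multiple of e, as W is orthogonal to e on
    both sides; so the NDB identity passes to W. *)
Lemma phi_middle_bracket_l y z (x : W) :
  phi (vsval (middle_coord [lie y, z])) (vsval x) = phi [lie y, z] (vsval x).
Proof.
by rewrite val_middle_bracket linearBl linearZl_LR /= phi_e_middle mulr0 subr0.
Qed.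

Lemma phi_middle_bracket_r y z (x : W) :
  phi (vsval x) (vsval (middle_coord [lie y, z])) = phi (vsval x) [lie y, z].
Proof.
by rewrite val_middle_bracket linearBr linearZr_LR /= phi_middle_e mulr0 subr0.
Qed.

(** * The NDB Lie algebra on W *)

(** The bracket of I^perp / Re, carried over to W. *)
Definition middle_bracket (x y : W) : W :=
  middle_coord [lie vsval x, vsval y].

Fact middle_bracket_bilinear : bilinear_for *:%R *:%R middle_bracket.
Proof. 
by split=> u a x y; rewrite /middle_bracket linearP ?linearPl ?linearPr linearP.
Qed.

HB.instance Definition _ :=
  bilinear_isBilinear.Build R W W W *:%R *:%R middle_bracket
    middle_bracket_bilinear.

Fact middle_bracketxx x : middle_bracket x x = 0.
Proof. by rewrite /middle_bracket lie_bracketxx linear0. Qed.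

Fact middle_jacobi x y z :
  middle_bracket x (middle_bracket y z) + middle_bracket y (middle_bracket z x)
    + middle_bracket z (middle_bracket x y) = 0.
Proof.
by rewrite /middle_bracket !bracket_middle_r -!linearD lie_jacobi linear0.
Qed.

Definition middle_lie : lieAlgebra R :=
  @LieAlgebra R W middle_bracket middle_bracketxx middle_jacobi.

Definition middle_form (x y : W) : R := phi (vsval x) (vsval y).

Fact middle_form_bilinear : bilinear_for *%R *%R middle_form.
Proof.
by split=> u a x y; rewrite /middle_form linearP ?linearPl ?linearPr.
Qed.

HB.instance Definition _ :=
  bilinear_isBilinear.Build R W W R *%R *%R middle_form middle_form_bilinear.

(** If x in W is left orthogonal to W, then phi(x, -) vanishes on e and W, so it
    is a multiple of phi(e, -); by nondegeneracy x is a multiple of e, and W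
    meets Re only in 0. *)
Fact middle_form_nondegenerate : nondegenerate_form middle_form.
Proof.
apply: nondegenerate_formP => x x0.
pose c := phi (vsval x) d / phi e d.
have xE : vsval x = c *: e.
  apply/eqP; rewrite -subr_eq0; apply/eqP.
  apply: (nondegenerate_left phi_ndb.1) => z.
  rewrite linearBl linearZl_LR /= [z]coord_decomposition.
  rewrite !linearDr !linearZr_LR /= phi_middle_e phi_ee phi_e_middle.
  by rewrite -[phi (vsval x) (vsval _)]/(middle_form _ _) x0 /c; field.
have := phi_d_middle x; rewrite xE linearZr_LR /= => /eqP.
rewrite mulf_eq0 (negPf phi_de) orbF => /eqP c0.
by apply: val_inj; rewrite /= xE c0 scale0r.
Qed.

Fact middle_ndb : @ndb_structure R middle_lie middle_form.
Proof.
split=> [|x y z]; first exact: middle_form_nondegenerate.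
rewrite /skew_part /sym_part /= /middle_form /middle_bracket.
rewrite !phi_middle_bracket_l !phi_middle_bracket_r.
exact: (phi_ndb.2 (vsval x) (vsval y) (vsval z)).
Qed.

Definition middle_ndb_lie : ndbLieAlgebra R := NdbLieAlgebra middle_ndb.

(** * The double extension data *)

Definition middle_theta (x y : W) : R := e_coord [lie vsval x, vsval y].

Fact middle_theta_bilinear : bilinear_for *%R *%R middle_theta.
Proof.
by split=> u a x y; rewrite /middle_theta linearP ?linearPl ?linearPr linearP.
Qed.

HB.instance Definition _ :=
  bilinear_isBilinear.Build R W W R *%R *%R middle_theta middle_theta_bilinear.

Definition middle_D : 'End(W) :=
  linfun (middle_coord \o lie_bracket gt d \o vsval).

Definition middle_lambda : 'Hom(W, R^o) :=
  linfun (e_coord \o lie_bracket gt d \o vsval).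

(** In a double extension phi(x, d) is the sum of S(x, d) = alpha(x) and
    A(x, d) = alpha(x), whence the factor 1/2. *)
Definition middle_alpha : 'Hom(W, R^o) :=
  2^-1 *: (linfun (applyr phi d : gt -> R^o) \o linfun vsval)%VF.

Lemma middle_DE x : middle_D x = middle_coord [lie d, vsval x].
Proof. by rewrite lfunE. Qed.

Lemma middle_lambdaE x : middle_lambda x = e_coord [lie d, vsval x].
Proof. by rewrite lfunE. Qed.

Lemma middle_alphaE x : middle_alpha x = phi (vsval x) d / 2.
Proof. by rewrite scale_lfunE comp_lfunE !lfunE /= mulrC. Qed.

Local Notation k := (sym_part phi e d).
Local Notation l := (skew_part phi e d).

(** For z = w + c e with w in W, S(d, z) = alpha(w) + k c and
    A(z, d) = alpha(w) + l c.  At z = [u, v] these two formulas turn conditions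
    (3), (4), (5) into statements about phi on the whole algebra. *)
Lemma middle_alpha_sym u v :
  middle_alpha (middle_coord [lie u, v]) + k * e_coord [lie u, v]
    = sym_part phi d [lie u, v].
Proof.
have := e_coord_mul [lie u, v]; rewrite d_coord_bracket mul0r subr0.
rewrite middle_alphaE val_middle_bracket linearBl linearZl_LR /=.
by rewrite /sym_part => <-; field.
Qed.

Lemma middle_alpha_skew u v :
  middle_alpha (middle_coord [lie u, v]) + l * e_coord [lie u, v]
    = skew_part phi [lie u, v] d.
Proof.
have := e_coord_mul [lie u, v]; rewrite d_coord_bracket mul0r subr0.
rewrite middle_alphaE val_middle_bracket linearBl linearZl_LR /=.
by rewrite /skew_part => <-; field.
Qed.

Lemma sym_middle_bracket y z (x : W) :
  sym_part middle_form x (middle_coord [lie y, z])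
    = sym_part phi (vsval x) [lie y, z].
Proof.
by rewrite /sym_part /middle_form phi_middle_bracket_l phi_middle_bracket_r.
Qed.

Lemma skew_middle_bracket y z (x : W) :
  skew_part middle_form x (middle_coord [lie y, z])
    = skew_part phi (vsval x) [lie y, z].
Proof.
by rewrite /skew_part /middle_form phi_middle_bracket_l phi_middle_bracket_r.
Qed.

Fact middle_theta_skew x y : middle_theta x y = - middle_theta y x.
Proof. by rewrite /middle_theta lie_bracketC linearN. Qed.

Fact middle_theta_closed x y z :
  middle_theta (middle_bracket x y) z + middle_theta (middle_bracket y z) x
    + middle_theta (middle_bracket z x) y = 0.
Proof.
rewrite /middle_theta /middle_bracket !bracket_middle_l -!(linearD e_coord).
rewrite !(lie_bracketC [lie _, _]) -!opprD linearN.
by rewrite -addrA addrC lie_jacobi linear0 oppr0.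
Qed.

Fact middle_derivation : @derivation R middle_lie middle_D.
Proof.
move=> x y; rewrite !middle_DE /= /middle_bracket.
rewrite bracket_middle_l !bracket_middle_r -linearD; congr middle_coord.
exact: lie_leibniz.
Qed.

Fact middle_cond1 x y :
  middle_lambda (middle_bracket x y)
    = middle_theta (middle_D x) y + middle_theta x (middle_D y).
Proof.
rewrite middle_lambdaE /middle_theta !middle_DE /middle_bracket.
by rewrite bracket_middle_l !bracket_middle_r lie_leibniz linearD.
Qed.

Fact middle_cond2 x y :
  sym_part middle_form (middle_D x) y + sym_part middle_form x (middle_D y) = 0.
Proof.
rewrite (sym_partC middle_form) !middle_DE !sym_middle_bracket.
rewrite (ndb_sym_invariant phi_ndb (vsval y)) (ndb_sym_invariant phi_ndb d).
by rewrite (lie_bracketC _ d) linearNr addNr.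
Qed.

Fact middle_cond3 x y :
  middle_alpha (middle_bracket x y) + k * middle_theta x y
    - sym_part middle_form y (middle_D x) = 0.
Proof.
rewrite middle_alpha_sym middle_DE sym_middle_bracket.
by rewrite (ndb_sym_invariant phi_ndb (vsval y)) subrr.
Qed.

Fact middle_cond4 x : middle_alpha (middle_D x) + k * middle_lambda x = 0.
Proof.
rewrite middle_DE middle_lambdaE middle_alpha_sym.
exact: ndb_sym_bracketxx.
Qed.

(** With the terms in alpha and theta collected into A([x, y], d), this is the
    NDB identity at (x, y, d). *)
Fact middle_cond5 x y :
  skew_part middle_form (middle_D x) y + skew_part middle_form x (middle_D y)
    + middle_alpha (middle_bracket x y) + l * middle_theta x y
    + sym_part middle_form x (middle_D y) = 0.
Proof.
rewrite -(addrA _ (middle_alpha _)) middle_alpha_skew.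
rewrite (skew_partC middle_form (middle_D x)).
rewrite !middle_DE !skew_middle_bracket sym_middle_bracket.
have := phi_ndb.2 (vsval x) (vsval y) d.
rewrite (lie_bracketC (vsval y)) linearNr linearNl /=.
rewrite (skew_partC phi _ (vsval x)) (skew_partC phi _ (vsval y)).
by move=> H; lra.
Qed.

Fact middle_neq_kl : k != l.
Proof.
apply: contra_neq phi_de => kl.
have <- : k - l = phi d e by rewrite /sym_part /skew_part; field.
by rewrite kl subrr.
Qed.

Fact middle_neq_kNl : k != - l.
Proof.
apply: contra_neq phi_ed => kl.
have <- : k + l = phi e d by rewrite /sym_part /skew_part; field.
by rewrite kl addNr.
Qed.

Definition middle_data : doubleExtData middle_ndb_lie :=
  @DoubleExtData R middle_ndb_lie middle_theta middle_D middle_lambda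
    middle_alpha k (phi d d) l middle_theta_skew middle_theta_closed
    middle_derivation middle_neq_kl middle_neq_kNl middle_cond1 middle_cond2
    middle_cond3 middle_cond4 middle_cond5.

(** * The isomorphism *)

Definition reduction_map (z : gt) : double_ext_space (g := middle_ndb_lie) :=
  de_vec (g := middle_ndb_lie) (e_coord z) (middle_coord z) (d_coord z).

Fact reduction_map_linear : linear reduction_map.
Proof. by move=> a u v; rewrite /reduction_map !linearP. Qed.

HB.instance Definition _ :=
  GRing.isLinear.Build R gt (double_ext_space (g := middle_ndb_lie)) *:%R
    reduction_map reduction_map_linear.

Definition reduction_inv (u : double_ext_space (g := middle_ndb_lie)) : gt :=
  u.1.1 *: e + vsval (u.1.2 : W) + u.2 *: d.

Lemma reduction_mapK : cancel reduction_map reduction_inv.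
Proof. by move=> z; rewrite [RHS]coord_decomposition. Qed.

Lemma reduction_invK : cancel reduction_inv reduction_map.
Proof.
case=> [[a x] s]; rewrite /reduction_inv /=.
set z := (X in reduction_map X).
have sE : d_coord z = s.
  rewrite d_coordE /z !linearDr !linearZr_LR /= phi_ee phi_e_middle.
  by field.
have aE : e_coord z = a.
  rewrite e_coordE sE /z !linearDr !linearZr_LR /= phi_d_middle.
  by field.
apply: (@de_eq _ middle_ndb_lie) => //=; apply: val_inj.
by rewrite /= val_middle_coord aE sE /z addrAC addrK addrC addKr.
Qed.

Lemma bracket_decomposition u v :
  [lie u, v] = [lie vsval (middle_coord u), vsval (middle_coord v)]
    + d_coord u *: [lie d, vsval (middle_coord v)]
    - d_coord v *: [lie d, vsval (middle_coord u)].
Proof.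
rewrite [in LHS](coord_decomposition u) [in LHS](coord_decomposition v).
have eCr z : [lie z, e] = 0 by rewrite lie_bracketC eC oppr0.
rewrite !(linearDl, linearDr, linearZl_LR, linearZr_LR) /=.
rewrite !eC !eCr lie_bracketxx !scaler0 !addr0 !add0r.
by rewrite (lie_bracketC _ d) scalerN addrAC.
Qed.

Lemma reduction_map_bracket u v :
  reduction_map [lie u, v]
    = double_ext_bracket middle_data (reduction_map u) (reduction_map v).
Proof.
apply: (@de_eq _ middle_ndb_lie) => /=.
- rewrite {1}bracket_decomposition linearB linearD !linearZ /=.
  by rewrite !middle_lambdaE.
- rewrite {1}bracket_decomposition linearB linearD !linearZ /=.
  by rewrite !middle_DE.
- exact: d_coord_bracket.
Qed.

Lemma reduction_map_form u v :
  double_ext_form middle_data (reduction_map u) (reduction_map v) = phi u v.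
Proof.
rewrite /double_ext_form /= !middle_alphaE.
rewrite [in RHS](coord_decomposition u) [in RHS](coord_decomposition v).
rewrite !(linearDl, linearDr, linearZl_LR, linearZr_LR) /=.
rewrite phi_ee phi_e_middle phi_middle_e phi_d_middle.
by rewrite /sym_part /skew_part /middle_form; field.
Qed.

Lemma reduction_iso :
  ndb_isomorphic (NdbLieAlgebra phi_ndb) (double_extension middle_data).
Proof.
split; apply: (@NdbIso _ (NdbLieAlgebra phi_ndb)
  (double_extension middle_data) (linfun reduction_map)).
- exists reduction_inv => z; rewrite lfunE; first exact: reduction_mapK.
  exact: reduction_invK.
- by move=> u v; rewrite !lfunE; apply: reduction_map_bracket.
- by move=> u v; rewrite !lfunE; apply: reduction_map_form.
Qed.

End Reduction.

(** * Codimension one *)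

Lemma codim1_decomposition (K : fieldType) (V : vectType K)
    (I : {vspace V}) d z :
  (\dim I).+1 = \dim {:V} -> d \notin I ->
  exists s, z - s *: d \in I.
Proof.
move=> dimI dI.
have full : (I + <[d]>)%VS = fullv.
  apply/eqP; rewrite -dimv_leqif_eq ?subvf // -dimI dimv_disjoint_sum.
    rewrite dim_vline; case: (eqVneq d 0) dI => [->|_ _].
      by rewrite mem0v.
    by rewrite addn1.
  apply/eqP; rewrite -subv0; apply/subvP => w; rewrite memv_cap.
  case/andP=> wI /vlineP[c cE]; move: wI; rewrite cE.
  rewrite rpredZeq (negPf dI) orbF => /eqP ->.
  by rewrite scale0r mem0v.
have := memvf z; rewrite -full => /memv_addP[i iI [w /vlineP[s ->] ->]].
by exists s; rewrite addrK.
Qed.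

Theorem theorem4p5 (R : realType) (n : nat) (gt : lieAlgebra R)
  (phit : {biscalar gt}) (phit_ndb : ndb_structure phit)
  (dim_gt : \dim {:gt} = n)
  (hI : exists e : gt,
     [/\ e != 0, in_center e, phit e e = 0 &
         exists2 I : {vspace gt},
           (forall x : gt, x \in I <-> phit e x = 0 /\ phit x e = 0) &
           (\dim I).+1 = n]) :
  exists (g : ndbLieAlgebra R) (E : doubleExtData g),
    ndb_isomorphic (NdbLieAlgebra phit_ndb) (double_extension E).
Proof.
case: hI => e [e0 eC phi_ee [I memI dimI]].
have [d _ dI] : exists2 d, d \in {:gt}%VS & d \notin I.
  apply/subvPn; apply/negP => /dimvS.
  by rewrite dim_gt -dimI ltnn.
(* phi(e, -) and phi(-, e) both vanish on I, so each is determined by its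
   value at d. *)
have dec z : exists2 s, phit e z = s * phit e d & phit z e = s * phit d e.
  have [|s] := codim1_decomposition z _ dI; first by rewrite dimI dim_gt.
  move/memI; rewrite linearBr linearZr_LR linearBl linearZl_LR /=.
  by move=> [/eqP + /eqP]; rewrite !subr_eq0 => /eqP ? /eqP ?; exists s.
have phi_ed : phit e d != 0.
  apply: contraNneq e0 => ed0; apply/eqP.
  apply: (nondegenerate_left phit_ndb.1) => z.
  by have [s -> _] := dec z; rewrite ed0 mulr0.
have phi_de : phit d e != 0.
  apply: contraNneq e0 => de0; apply/eqP.
  apply: (nondegenerate_right phit_ndb.1) => z.
  by have [s _ ->] := dec z; rewrite de0 mulr0.
have phi_e_left z : phit e z = 0 -> phit z e = 0.
  have [s -> ->] := dec z => /eqP.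
  by rewrite mulf_eq0 (negPf phi_ed) orbF => /eqP ->; rewrite mul0r.
eexists; eexists.
exact: (reduction_iso phit_ndb eC phi_ee phi_ed phi_de phi_e_left).
Qed.
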